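(* Let $\hat f:=\arg\min_{f\in\mathbb R^n}\{R_n(f)+\lambda\,\mathrm{TV}(f)\}$. Let $\mathrm{TV}(f^0)\le M_0$ for some constant $M_0\ge1$. Define $K>0$ by $$K^2:=\frac{(1+e^{1+2^4M_0+\|f^0\|_\infty})^2}{e^{1+2^4M_0+\|f^0\|_\infty}}.$$ Suppose that $$\lambda\le\left(2^4(2K^2)M_0\right)^{-1},\qquad \lambda\ge2^8n^{-2/3}A_0^{2/3}(2K^2)^{1/3},\qquad \lambda\ge2^8(2K^2)\frac{1+t}{n},$$ where the last inequality holds for some $t>0$. Then with probability at least $1-\exp[-t]$ it holds that $$\frac{\|\hat f-f^0\|_{Q_n}^2}{2K^2}+\lambda\,\mathrm{TV}(\hat f-f^0)\le4\lambda M_0$$ and $$\|\hat f-f^0\|_\infty\le\frac{1+8M_0}{2}.$$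
   Context: $Y_1,\dots,Y_n\in\{0,1\}$ are independent, $\theta_i^0:=\mathbb P(Y_i=1)$, and $f_i^0:=\log(\theta_i^0/(1-\theta_i^0))\in\mathbb R$, $f^0=(f^0_1,\dots,f^0_n)$. For $f\in\mathbb R^n$: $\mathrm{TV}(f):=\sum_{i=2}^n|f_i-f_{i-1}|$, $\|f\|_\infty:=\max_i|f_i|$, $\|f\|_{Q_n}:=\|f\|_2/\sqrt n$ with $\|\cdot\|_2$ the Euclidean norm, and $R_n(f):=\frac1n\sum_{i=1}^n(-Y_if_i+\log(1+e^{f_i}))$. $A_0$ is a universal constant such that, for every $n$, every probability measure $\mathbf Q$ on $\{1,\dots,n\}$ and every $u>0$, the set $\{g\in\mathbb R^n:\|g\|_\infty\le1,\ \mathrm{TV}(g)\le1\}$ has $u$-entropy (logarithm of the smallest number of points of the set such that every element is within distance $u$ of one of them) at most $A_0/u$ for the $L_2(\mathbf Q)$-norm. *)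

(* Defs.v *)
From HB Require Import structures.
From mathcomp Require Import all_boot all_order all_algebra.
From mathcomp Require Import all_classical all_reals all_analysis.

Set Implicit Arguments.
Unset Strict Implicit.
Unset Printing Implicit Defensive.
Import Order.TTheory GRing.Theory Num.Theory.
Import numFieldNormedType.Exports.
Local Open Scope classical_set_scope.
Local Open Scope ring_scope.

(* A vector of R^n is a row f : 'rV[R]_n, with the paper's f_i written f 0 i
   and indices running over 0, ..., n-1.  The library norm `|f| on 'rV[R]_n is
   the maximum of the absolute values of the entries, i.e. the sup norm. *)

Definition TV (R : realType) (n : nat) (f : 'rV[R]_n) : R :=
  \sum_(p : 'I_n * 'I_n | p.2 == p.1.+1 :> nat) `|f 0 p.2 - f 0 p.1|.

Definition norm2 (R : realType) (n : nat) (f : 'rV[R]_n) : R :=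
  Num.sqrt (\sum_(i < n) f 0 i ^+ 2).

Definition normQn (R : realType) (n : nat) (f : 'rV[R]_n) : R :=
  norm2 f / Num.sqrt n%:R.

Definition is_prob_weight (R : realType) (n : nat) (q : 'I_n -> R) : Prop :=
  (forall i, 0 <= q i) /\ \sum_(i < n) q i = 1.

Definition normL2 (R : realType) (n : nat) (q : 'I_n -> R) (f : 'rV[R]_n) : R :=
  Num.sqrt (\sum_(i < n) q i * f 0 i ^+ 2).

(* The centers of a covering are required to lie in the covered set. *)
Definition is_cover (R : realType) (V : zmodType) (N : V -> R) (S : set V)
    (u : R) (s : seq V) : Prop :=
  (forall g, g \in s -> S g) /\
  (forall f, S f -> exists2 g, g \in s & N (f - g) <= u).

(* Equals +oo when there is no finite covering. *)
Definition covering_number (R : realType) (V : zmodType) (N : V -> R)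
    (S : set V) (u : R) : \bar R :=
  ereal_inf [set ((size s)%:R : R)%:E | s in is_cover N S u].

Definition entropy (R : realType) (V : zmodType) (N : V -> R)
    (S : set V) (u : R) : \bar R :=
  lne (covering_number N S u).

Definition TV_ball (R : realType) (n : nat) : set 'rV[R]_n :=
  [set g | `|g| <= 1 /\ TV g <= 1].

Definition TV_entropy_constant (R : realType) (A0 : R) : Prop :=
  forall (n : nat) (q : 'I_n -> R) (u : R), is_prob_weight q -> 0 < u ->
    (entropy (normL2 q) (@TV_ball R n) u <= (A0 / u)%:E)%E.

Definition mutually_independent (d d' : measure_display)
    (T : measurableType d) (T' : measurableType d') (R : realType)
    (P : probability T R) (I : finType) (X : I -> {RV P >-> T'}) : Prop :=
  forall (J : {set I}) (B : I -> set T'), (forall i, measurable (B i)) ->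
    (P (\bigcap_(i in [set` J]) (X i @^-1` B i)) =
     \prod_(i in J) P (X i @^-1` B i))%E.

Definition success_prob (d : measure_display) (T : measurableType d)
    (R : realType) (P : probability T R) (X : {RV P >-> bool}) : R :=
  fine (P (X @^-1` [set true])).

Definition log_odds (d : measure_display) (T : measurableType d)
    (R : realType) (P : probability T R) (n : nat)
    (Y : 'I_n -> {RV P >-> bool}) : 'rV[R]_n :=
  \row_i ln (success_prob (Y i) / (1 - success_prob (Y i))).

Definition logistic_risk (R : realType) (n : nat) (y : {ffun 'I_n -> bool})
    (f : 'rV[R]_n) : R :=
  n%:R^-1 * \sum_(i < n) (- ((y i)%:R * f 0 i) + ln (1 + expR (f 0 i))).

Definition TV_objective (R : realType) (n : nat) (lambda : R)
    (y : {ffun 'I_n -> bool}) (f : 'rV[R]_n) : R :=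
  logistic_risk y f + lambda * TV f.

Definition argmin (R : realType) (V : Type) (F : V -> R) : set V :=
  [set f | forall g, F f <= F g].

(* For some data vectors (e.g. all labels equal) the objective has no
   minimizer, so an estimator is only required to be a minimizer when one
   exists.  Its value is unconstrained elsewhere, so that a bound stated for
   every such estimator cannot hold through data without a minimizer.
   Minimizers are unique by strict convexity of the logistic risk, hence
   nothing is lost in taking the estimator to be a function of the data. *)
Definition is_TV_logistic_estimator (R : realType) (n : nat) (lambda : R)
    (fhat : {ffun 'I_n -> bool} -> 'rV[R]_n) : Prop :=
  forall y, argmin (TV_objective lambda y) !=set0 ->
    argmin (TV_objective lambda y) (fhat y).

(* Main.v *)
Require Import Defs.
From HB Require Import structures.
From mathcomp Require Import all_boot all_order all_algebra.
From mathcomp Require Import all_classical all_reals all_analysis.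
From mathcomp Require Import ring lra.

Set Implicit Arguments.
Unset Strict Implicit.
Unset Printing Implicit Defensive.
Import Order.TTheory GRing.Theory Num.Theory.
Import numFieldNormedType.Exports.
Local Open Scope classical_set_scope.
Local Open Scope ring_scope.

(** Why the theorem holds.

The logistic loss is governed by one function, the softplus x |-> log (1 + e^x),
whose derivative is the sigmoid and whose second derivative is
e^x / (1 + e^x)^2.  Two bounds on this second derivative drive everything:
- it is at least 1 / K^2 on the range of the functions that matter, so the
  excess risk of f over f0 dominates |f - f0|_n^2 / (2 K^2), where |.|_n is the
  empirical L2 norm (bregman_softplus_ge);
- it is at most 1/4 everywhere.  As the cumulant function of a centred Bernoulli
  variable is a Bregman divergence of the softplus, this is Hoeffding's
  inequality (bernoulli_subgaussian), which makes the noise process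
  g |-> (1/n) sum_i (Y_i - theta_i) g_i sub-Gaussian for |.|_n (noise_tail).

Deterministic part. Let the gauge of g be |g|_n^2 / (2 K^2) + lambda TV g, and
L = 4 lambda M0. If the noise is smaller than L - 2 lambda TV f0 on the ball of
gauge at most L, then no f with gauge (f - f0) > L has an objective as small as
that of f0: sliding f towards f0 until the gauge is exactly L, the objective
stays at most that of f0 by convexity, which contradicts the basic inequality
(objective_gt_outside). Hence minimizers exist, by compactness, and all of them
lie in the ball (argmin_exists, argmin_in_gauge_ball). The condition lambda <=
1 / (16 (2 K^2) M0) gives the ball radius r <= 1/2 for |.|_n, and a vector is
bounded by its total variation plus its norm |.|_n, whence the sup norm bound
(1 + 8 M0) / 2; it is also what keeps the argument inside the range where the
lower bound 1 / K^2 is valid.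

Probabilistic part. With probability at least 1 - e^-t the noise is at most
(3/2) lambda M0 on the ball. This is chaining with a union bound over the links
of the chains (chaining_tail): at scale r / 4^k the ball, which lies in 5 M0
times the unit TV ball, has a net of at most exp (4^k h) points with h = 10 M0
A0 / r, and every link of length r / 4^k exceeds its Hoeffding level with
probability at most exp (- 4^(k+1) (1 + t + h)). The levels sum to 4 r sqrt ((1
+ t + h) / (2 n)), a geometric series, and the two lower bounds on lambda make
this at most lambda M0 (chaining_level_le). Working with tail probabilities
along the chains avoids both expectations of suprema and a concentration
inequality.

Everything random factors through the label vector, so probabilities are finite
sums against a product weight on {0,1}^n (independent_labels_law). *)

(** * The softplus function *)

Section softplus.
Context {R : realType}.
Implicit Types (x y c B : R) (f df ddf : R -> R).

Lemma MVT_between f df x y :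
  (forall z : R, is_derive z 1 f (df z)) ->
  exists2 z, Num.min x y <= z <= Num.max x y & f x - f y = df z * (x - y).
Proof.
move=> dfE.
have cf : continuous f.
  by move=> z; apply/differentiable_continuous/derivable1_diffP; case: (dfE z).
have [xy|/ltW yx] := leP x y.
  have [z zI E] := MVT_segment xy (fun z _ => dfE z) (continuous_subspaceT cf).
  by exists z => //; rewrite -opprB E -mulrN opprB.
have [z zI E] := MVT_segment yx (fun z _ => dfE z) (continuous_subspaceT cf).
by exists z.
Qed.

(** f minus the parabola c z^2 / 2 has a nondecreasing derivative on I, so two
applications of the mean value theorem place it above its tangent at y. *)
Lemma second_order_ge f df ddf c (I : interval R) x y :
  (forall z : R, is_derive z 1 f (df z)) ->
  (forall z : R, is_derive z 1 df (ddf z)) ->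
  (forall z, z \in I -> c <= ddf z) -> x \in I -> y \in I ->
  c / 2 * (x - y) ^+ 2 <= f x - f y - df y * (x - y).
Proof.
move=> dfE ddfE cI xI yI.
pose h := f - (c / 2) *: (@GRing.exp R ^~ 2%N); pose dh := df - c *: id.
have dhE (z : R) : is_derive z 1 h (dh z).
  rewrite /h /dh; apply: is_derive_eq => /=; rewrite !fctE /= /GRing.scale /=.
  by field.
have ddhE (z : R) : is_derive z 1 dh (ddf z - c).
  rewrite /dh; apply: is_derive_eq; rewrite /GRing.scale /=; ring.
(* h x - h y = h' z (x - y), and h' z - h' y has the sign of x - y. *)
have [z /andP[zl zu] Ez] := MVT_between x y dhE.
have [v /andP[vl vu] Ev] := MVT_between z y ddhE.
have inI u : Num.min x y <= u <= Num.max x y -> u \in I.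
  move=> uxy; case: (leP x y) uxy => xy uxy.
    by apply: (interval_is_interval xI yI uxy).
  by apply: (interval_is_interval yI xI uxy).
have vI : c <= ddf v.
  apply/cI/inI/andP; split.
    by apply: le_trans vl; rewrite le_min zl ge_min lexx orbT.
  by apply: (le_trans vu); rewrite ge_max zu le_max lexx orbT.
have zy : 0 <= (z - y) * (x - y).
  have [xy|/ltW xy] := leP x y.
    have zley : z <= y by move: zu; rewrite max_r.
    by rewrite mulr_le0// subr_le0.
  have ylez : y <= z by move: zl; rewrite min_r.
  by rewrite mulr_ge0// subr_ge0.
have : 0 <= (dh z - dh y) * (x - y).
  by rewrite Ev -mulrA mulr_ge0// subr_ge0.
rewrite mulrBl -Ez subr_ge0 /h /dh !fctE /= /GRing.scale /=.
lra.
Qed.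

Definition softplus x := ln (1 + expR x).
Definition sigmoid x := expR x / (1 + expR x).

(** Gap between the softplus and its tangent at y. It is at once the excess
logistic risk at x when y is the true log-odds, and the value at x - y of the
log-moment generating function of a centred Bernoulli label of log-odds y. *)
Definition bregman_softplus x y :=
  softplus x - softplus y - sigmoid y * (x - y).

Lemma oneDexpR_gt0 x : 0 < 1 + expR x.
Proof. by rewrite ltr_wpDr// expR_ge0. Qed.

Lemma is_derive_softplus x : is_derive x 1 softplus (sigmoid x).
Proof.
have h : is_derive x (1 : R) (cst 1 + expR : R -> R) (expR x).
  by apply: is_derive_eq; rewrite add0r.
have := @is_derive1_comp _ (@ln R) (cst 1 + expR) x _ _
  (is_derive1_ln (oneDexpR_gt0 x)) h.
by rewrite mulrC.
Qed.

Lemma sigmoidE x : sigmoid x = 1 - (1 + expR x)^-1.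
Proof. by rewrite /sigmoid; field; rewrite gt_eqF// oneDexpR_gt0. Qed.

Lemma sigmoid_itv x : 0 <= sigmoid x <= 1.
Proof.
rewrite /sigmoid divr_ge0 ?expR_ge0 ?(ltW (oneDexpR_gt0 x))//=.
by rewrite ler_pdivrMr ?oneDexpR_gt0// mul1r lerDr.
Qed.

Lemma is_derive_sigmoid x :
  is_derive x 1 sigmoid (expR x / (1 + expR x) ^+ 2).
Proof.
have h : is_derive x (1 : R) (cst 1 + expR : R -> R) (expR x).
  by apply: is_derive_eq; rewrite add0r.
have x0 : 1 + expR x != 0 by rewrite gt_eqF// oneDexpR_gt0.
have -> : sigmoid = cst 1 - (fun z : R => ((cst 1 + expR : R -> R) z)^-1).
  by apply/funext => z; exact: sigmoidE.
have h2 := @is_deriveV _ (cst 1 + expR : R -> R) _ _ _ x0 h.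
apply: is_derive_eq; rewrite /GRing.scale /=.
by rewrite sub0r mulNr opprK mulrC.
Qed.

Lemma softplus_dd_le x : expR x / (1 + expR x) ^+ 2 <= 4^-1.
Proof.
rewrite ler_pdivrMr ?exprn_gt0 ?oneDexpR_gt0//.
by have := sqr_ge0 (1 - expR x); nra.
Qed.

(** The second derivative is even and decreases with |x|. *)
Lemma softplus_dd_ge B x : `|x| <= B ->
  expR B / (1 + expR B) ^+ 2 <= expR x / (1 + expR x) ^+ 2.
Proof.
rewrite ler_norml => /andP[Bx xB].
have a0 := expR_gt0 x; have b0 := expR_gt0 B.
rewrite ler_pdivrMr ?exprn_gt0 ?oneDexpR_gt0//.
rewrite mulrAC ler_pdivlMr ?exprn_gt0 ?oneDexpR_gt0//.
have ab : expR x <= expR B by rewrite ler_expR.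
have ab1 : 1 <= expR x * expR B by rewrite -expRD -expR0 ler_expR; lra.
by nra.
Qed.

(** This is the form that gives Hoeffding's constant 1/8, as the second
derivative is at most 1/4. *)
Lemma bregman_softplus_le x y : bregman_softplus x y <= (x - y) ^+ 2 / 8.
Proof.
have dN z := @is_deriveN _ _ _ softplus z 1 _ (is_derive_softplus z).
have ddN z := @is_deriveN _ _ _ sigmoid z 1 _ (is_derive_sigmoid z).
have := second_order_ge (c := - 4^-1) (I := `]-oo, +oo[) (x := x) (y := y)
  dN ddN.
rewrite !fctE => /(_ _ isT isT) H.
have {H} := H (fun z _ => etrans (lerN2 _ _) (softplus_dd_le z)).
rewrite /bregman_softplus; lra.
Qed.

Lemma bregman_softplus_ge B x y : `|x| <= B -> `|y| <= B ->
  expR B / (1 + expR B) ^+ 2 / 2 * (x - y) ^+ 2 <= bregman_softplus x y.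
Proof.
move=> xB yB; apply: (second_order_ge (I := `[- B, B])
  is_derive_softplus is_derive_sigmoid).
- by move=> z; rewrite in_itv/= -ler_norml; exact: softplus_dd_ge.
- by rewrite in_itv/= -ler_norml.
- by rewrite in_itv/= -ler_norml.
Qed.

Lemma bregman_softplus_ge0 x y : 0 <= bregman_softplus x y.
Proof.
apply: le_trans (@bregman_softplus_ge (Num.max `|x| `|y|) _ _ _ _).
- by rewrite mulr_ge0 ?sqr_ge0// divr_ge0// divr_ge0 ?expR_ge0// sqr_ge0.
- by rewrite le_max lexx.
- by rewrite le_max lexx orbT.
Qed.

Lemma softplus_convex s x y : 0 <= s <= 1 ->
  softplus (x + s * (y - x)) <= (1 - s) * softplus x + s * softplus y.
Proof.
move=> /andP[s0 s1]; set z := x + _.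
have := bregman_softplus_ge0 x z; have := bregman_softplus_ge0 y z.
rewrite /bregman_softplus.
have -> : y - z = (1 - s) * (y - x) by rewrite /z; ring.
have -> : x - z = - s * (y - x) by rewrite /z; ring.
move=> /(mulr_ge0 s0) ?; have s1' : 0 <= 1 - s by rewrite subr_ge0.
move=> /(mulr_ge0 s1').
lra.
Qed.

(** Hoeffding's inequality for a Bernoulli variable with success probability
sigmoid x: the left-hand side is exactly exp (bregman_softplus (x + s) x). *)
Lemma bernoulli_subgaussian x s :
  sigmoid x * expR (s * (1 - sigmoid x))
    + (1 - sigmoid x) * expR (s * (0 - sigmoid x)) <= expR (s ^+ 2 / 8).
Proof.
have e1 : expR (softplus (x + s)) = 1 + expR x * expR s.
  by rewrite lnK ?posrE ?oneDexpR_gt0// expRD.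
have e2 : expR (softplus x) = 1 + expR x by rewrite lnK ?posrE ?oneDexpR_gt0.
apply: (@le_trans _ _ (expR (bregman_softplus (x + s) x))); last first.
  by rewrite ler_expR (le_trans (bregman_softplus_le _ _))// addrAC subrr add0r.
have x0 : 1 + expR x != 0 by rewrite gt_eqF// oneDexpR_gt0.
rewrite /bregman_softplus; have -> : x + s - x = s by ring.
have -> : s * (1 - sigmoid x) = s + - (sigmoid x * s) by ring.
have -> : s * (0 - sigmoid x) = - (sigmoid x * s) by ring.
rewrite !expRD e1 (expRN (softplus x)) e2; set E := expR (- _).
rewrite /sigmoid le_eqVlt; apply/orP; left; apply/eqP.
by field.
Qed.

End softplus.

(** * Product Bernoulli law and sub-Gaussian noise *)

Section product_law.
Context {R : realType}.

Definition bernoulli_weight (n : nat) (p : 'I_n -> R)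
    (y : {ffun 'I_n -> bool}) : R :=
  \prod_i (if y i then p i else 1 - p i).

Lemma bernoulli_weight_ge0 n (p : 'I_n -> R) y :
  (forall i, 0 <= p i <= 1) -> 0 <= bernoulli_weight p y.
Proof.
move=> p01; apply: prodr_ge0 => i _; have /andP[p0 p1] := p01 i.
by case: ifP => // _; rewrite subr_ge0.
Qed.

Lemma bernoulli_weight_expectation n (p : 'I_n -> R) (F : 'I_n -> bool -> R) :
  \sum_y bernoulli_weight p y * \prod_i F i (y i) =
  \prod_i (p i * F i true + (1 - p i) * F i false).
Proof.
transitivity (\prod_i \sum_(b : bool) (if b then p i else 1 - p i) * F i b).
  by rewrite bigA_distr_bigA; apply: eq_bigr => y _; rewrite -big_split.
by apply: eq_bigr => i _; rewrite big_bool.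
Qed.

Lemma sum_bernoulli_weight n (p : 'I_n -> R) : \sum_y bernoulli_weight p y = 1.
Proof.
transitivity (\sum_y bernoulli_weight p y * \prod_(i < n) 1).
  by apply: eq_bigr => y _; rewrite big1 ?mulr1.
rewrite (bernoulli_weight_expectation p (fun _ _ => 1)) big1// => i _.
by rewrite !mulr1 addrC subrK.
Qed.

Context d (T : measurableType d) (P : probability T R).

(** Events that depend on the labels only are finite disjoint unions of atoms
on which every label is prescribed; independence factorizes their
probabilities. *)
Lemma independent_labels_law n (Y : 'I_n -> {RV P >-> bool})
    (Q : pred {ffun 'I_n -> bool}) : mutually_independent Y ->
  P [set w | Q [ffun i => Y i w]] =
  (\sum_(y | Q y) bernoulli_weight (fun i => success_prob (Y i)) y)%:E.
Proof.
move=> indY.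
have mB i (B : set bool) : measurable (Y i @^-1` B).
  by rewrite -[X in measurable X]setTI; exact: measurable_funPT.
pose atom (y : {ffun 'I_n -> bool}) : set T :=
  \bigcap_(i in [set` [set: 'I_n]%SET]) (Y i @^-1` [set y i]).
have atomE y w : atom y w <-> [ffun i => Y i w] = y.
  split=> [h|<- i _]; last by rewrite /= ffunE.
  by apply/ffunP => i; rewrite ffunE; apply: h => /=; rewrite inE.
have P_atom y : P (atom y) =
    (bernoulli_weight (fun i => success_prob (Y i)) y)%:E.
  rewrite indY; last by move=> i.
  rewrite /bernoulli_weight -prodEFin big_mkcond/=; apply: eq_bigr => i _.
  rewrite inE /success_prob.
  have Pfin : P (Y i @^-1` [set true]) \is a fin_num by apply: fin_num_measure.
  case: (y i); first by rewrite fineK.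
  rewrite EFinB fineK// -probability_setC//; congr (P _).
  by apply/seteqP; split => w /=; case: (Y i w).
have -> : [set w | Q [ffun i => Y i w]] = \bigcup_(y in [set` Q]) atom y.
  apply/seteqP; split => [w /= Qw|w [y /= Qy /atomE ->]//].
  by exists [ffun i => Y i w] => //; exact/atomE.
rewrite measure_fin_bigcup//.
- rewrite -(@bigfs _ _ _ _ (index_enum _)) ?index_enum_uniq//; last first.
    by move=> y _; rewrite mem_index_enum.
  by rewrite -sumEFin; apply: eq_bigr => y _; exact: P_atom.
- by move=> y z _ _ [w [/atomE <- /atomE <-]].
- by move=> y _; apply: fin_bigcap_measurable => // i _; exact: mB.
Qed.

End product_law.

Section empirical_noise.
Context {R : realType} {n : nat}.
Implicit Types (f g : 'rV[R]_n) (y : {ffun 'I_n -> bool}).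

Lemma normQn_ge0 g : 0 <= normQn g.
Proof. by rewrite /normQn divr_ge0// sqrtr_ge0. Qed.

Lemma normQn_sqr g : normQn g ^+ 2 = n%:R^-1 * \sum_i g 0 i ^+ 2.
Proof.
rewrite /normQn /norm2 expr_div_n !sqr_sqrtr ?ler0n// 1?mulrC//.
by apply: sumr_ge0 => i _; exact: sqr_ge0.
Qed.

(** Law of the labels when f is the vector of true log-odds. *)
Definition label_weight f y := bernoulli_weight (fun i => sigmoid (f 0 i)) y.

Definition noise f y g : R :=
  n%:R^-1 * \sum_i ((y i)%:R - sigmoid (f 0 i)) * g 0 i.

Lemma noiseD f y g h : noise f y (g + h) = noise f y g + noise f y h.
Proof.
rewrite /noise -mulrDr -big_split; congr (_ * _).
by apply: eq_bigr => i _; rewrite mxE mulrDr.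
Qed.

Lemma noise_mgf f g s : (0 < n)%N ->
  \sum_y label_weight f y * expR (s * noise f y g) <=
  expR (s ^+ 2 * normQn g ^+ 2 / (8 * n%:R)).
Proof.
move=> n0; have n0' : n%:R != 0 :> R by rewrite pnatr_eq0 -lt0n.
pose c i := s / n%:R * g 0 i.
pose F (i : 'I_n) (b : bool) := expR (c i * (b%:R - sigmoid (f 0 i))).
have -> : \sum_y label_weight f y * expR (s * noise f y g) =
    \sum_y label_weight f y * \prod_i F i (y i).
  apply: eq_bigr => y _; rewrite /F -expR_sum; congr (_ * expR _).
  rewrite /noise mulrA mulr_sumr; apply: eq_bigr => i _.
  by rewrite /c -[RHS]mulrA [g _ _ * _]mulrC.
rewrite bernoulli_weight_expectation.
have -> : expR (s ^+ 2 * normQn g ^+ 2 / (8 * n%:R)) =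
    \prod_(i < n) expR (c i ^+ 2 / 8).
  rewrite -expR_sum normQn_sqr; congr expR.
  rewrite mulrA mulrAC mulr_sumr.
  by apply: eq_bigr => i _; rewrite /c; field.
apply: ler_prod => i _; rewrite bernoulli_subgaussian andbT.
have s0 : 0 <= sigmoid (f 0 i) <= 1 by exact: sigmoid_itv.
have /andP[sg0 sg1] := s0.
by rewrite addr_ge0// mulr_ge0 ?expR_ge0 ?subr_ge0.
Qed.

Lemma label_weight_ge0 f y : 0 <= label_weight f y.
Proof. by apply: bernoulli_weight_ge0 => i; exact: sigmoid_itv. Qed.

(** Chernoff's bound at s = 4 n a / r, the minimizer of
s^2 r^2 / (8 n) - s r a. *)
Lemma noise_tail f g r x : (0 < n)%N -> 0 < r -> 0 <= x -> normQn g <= r ->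
  \sum_(y | r * Num.sqrt (x / (2 * n%:R)) < noise f y g) label_weight f y
    <= expR (- x).
Proof.
move=> n0 r0 x0 gr; have n0' : 0 < n%:R :> R by rewrite ltr0n.
set a := Num.sqrt _; set s := 4 * n%:R * a / r.
have a0 : 0 <= a by exact: sqrtr_ge0.
have s0 : 0 <= s by rewrite divr_ge0 ?mulr_ge0// ltW.
have a2 : a ^+ 2 = x / (2 * n%:R).
  by rewrite sqr_sqrtr// divr_ge0// mulr_ge0// ltW.
apply: (@le_trans _ _
    (\sum_y label_weight f y * expR (s * noise f y g)
       * expR (- (s * (r * a))))).
  rewrite big_mkcond/=; apply: ler_sum => y _.
  have w0 := label_weight_ge0 f y.
  case: ifPn => [ay|_]; last by rewrite !mulr_ge0// expR_ge0.
  rewrite -mulrA -expRD -mulrBr ler_peMr// -expR0 ler_expR.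
  by rewrite mulr_ge0// subr_ge0 ltW.
rewrite -mulr_suml.
apply: (@le_trans _ _
    (expR (s ^+ 2 * r ^+ 2 / (8 * n%:R)) * expR (- (s * (r * a))))).
  apply: ler_wpM2r; first exact: expR_ge0.
  apply: (le_trans (noise_mgf _ _ _ n0)); rewrite ler_expR.
  apply: ler_wpM2r; first by rewrite invr_ge0 mulr_ge0// ltW.
  apply: ler_wpM2l; first exact: sqr_ge0.
  by rewrite lerXn2r// nnegrE ?normQn_ge0// ltW.
rewrite -expRD ler_expR /s.
have -> : (4 * n%:R * a / r) ^+ 2 * r ^+ 2 / (8 * n%:R)
    - 4 * n%:R * a / r * (r * a) = - (2 * n%:R) * a ^+ 2.
  by field; rewrite !gt_eqF.
by rewrite a2 le_eqVlt; apply/orP; left; apply/eqP; field; rewrite gt_eqF.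
Qed.

End empirical_noise.

(** * Total variation and coverings *)

Section total_variation.
Context {R : realType} {n : nat}.
Implicit Types (f g : 'rV[R]_n) (a : R).

Lemma TV_ge0 g : 0 <= TV g.
Proof. exact: sumr_ge0. Qed.

Lemma TVZ a g : TV (a *: g) = `|a| * TV g.
Proof.
by rewrite /TV mulr_sumr; apply: eq_bigr => p _; rewrite !mxE -mulrBr normrM.
Qed.

Lemma TVN g : TV (- g) = TV g.
Proof. by rewrite -scaleN1r TVZ normrN1 mul1r. Qed.

Lemma TVD f g : TV (f + g) <= TV f + TV g.
Proof.
rewrite /TV -big_split; apply: ler_sum => p _ /=; rewrite !mxE.
by rewrite (le_trans _ (ler_normD _ _))//; rewrite opprD addrACA.
Qed.

End total_variation.

Lemma TV_consecutive (R : realType) m (g : 'rV[R]_m.+1) :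
  TV g = \sum_(0 <= k < m) `|g 0 (inord k.+1) - g 0 (inord k)|.
Proof.
rewrite /TV -(pair_big_dep xpredT (fun i j : 'I_m.+1 => j == i.+1 :> nat)
  (fun i j => `|g 0 j - g 0 i|)) /=.
rewrite big_ord_recr /= [X in _ + X]big_pred0 ?addr0; last first.
  by move=> j; rewrite ltn_eqF.
rewrite big_mkord; apply: eq_bigr => k _.
rewrite (big_pred1 (inord k.+1)) => [|j].
  by congr (`|_ - g 0 _|); apply: val_inj; rewrite /= inordK// ltnS ltnW.
have kE : nat_of_ord (inord k.+1 : 'I_m.+1) = k.+1 by rewrite inordK// ltnS.
apply/eqP/eqP => [h|->]; last exact: kE.
by apply: val_inj; rewrite /= kE.
Qed.

Lemma coord_diff_le_TV (R : realType) n (g : 'rV[R]_n) i j :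
  `|g 0 j - g 0 i| <= TV g.
Proof.
case: n g i j => [|m] g i j; first by case: i.
wlog ij : i j / (i <= j)%N => [H|].
  by case/orP: (leq_total i j) => /H//; rewrite distrC.
rewrite TV_consecutive -{1}[j]inord_val -{1}[i]inord_val.
have jm : (j <= m)%N by rewrite -ltnS.
rewrite -(telescope_sumr (fun k => g 0 (inord k)) ij).
rewrite (le_trans (ler_norm_sum _ _ _))//.
rewrite (big_cat_nat (leq0n i) (leq_trans ij jm)) /=.
rewrite (big_cat_nat ij jm) /= -[leLHS]add0r lerD ?sumr_ge0//.
by rewrite lerDl sumr_ge0.
Qed.

Lemma rV_norm_le (R : realType) n (g : 'rV[R]_n) c : 0 <= c ->
  (`|g| <= c) <-> (forall i, `|g 0 i| <= c).
Proof.
move=> c0; rewrite [`|g|]/Num.norm /= mx_normrE; split=> [/bigmax_leP[_ h] i|h].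
  by apply: (h (0, i)).
by apply/bigmax_leP; split=> // -[i j] _; rewrite /= ord1.
Qed.

(** Some entry is at most the quadratic mean, and no entry is farther than TV g
from it. *)
Lemma norm_le_TV_normQn (R : realType) n (g : 'rV[R]_n) : (0 < n)%N ->
  `|g| <= TV g + normQn g.
Proof.
move=> n0; have n0' : 0 < n%:R :> R by rewrite ltr0n.
have [i gi] : exists i, `|g 0 i| <= normQn g.
  apply: contrapT => /forallNP h.
  have : \sum_(i < n) normQn g ^+ 2 < \sum_(i < n) g 0 i ^+ 2.
    apply: ltr_sum => [|i _].
      by apply/hasP; exists (Ordinal n0); rewrite ?mem_index_enum.
    rewrite -[ltRHS]real_normK ?num_real// ltrXn2r ?normQn_ge0//=.
    by rewrite ltNge; apply/negP/h.
  rewrite sumr_const card_ord -mulr_natl normQn_sqr mulrA divff ?gt_eqF// mul1r.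
  by rewrite ltxx.
apply/rV_norm_le; first by rewrite addr_ge0 ?TV_ge0 ?normQn_ge0.
move=> j; rewrite -[g 0 j](subrK (g 0 i)) (le_trans (ler_normD _ _))//.
by rewrite lerD// coord_diff_le_TV.
Qed.

Section coverings.
Context {R : realType} {n : nat}.
Hypothesis n_gt0 : (0 < n)%N.
Implicit Types (f g : 'rV[R]_n).

Lemma normQnN g : normQn (- g) = normQn g.
Proof.
rewrite /normQn /norm2; congr (Num.sqrt _ / _).
by apply: eq_bigr => i _; rewrite mxE sqrrN.
Qed.

Lemma normQnZ a g : normQn (a *: g) = `|a| * normQn g.
Proof.
rewrite /normQn /norm2 mulrA; congr (_ / _).
rewrite -sqrtr_sqr -sqrtrM ?sqr_ge0// mulr_sumr; congr Num.sqrt.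
by apply: eq_bigr => i _; rewrite mxE exprMn.
Qed.

(** The only instance of the triangle inequality that coverings call for; with
two equal bounds it follows from (a + b)^2 <= 2 a^2 + 2 b^2. *)
Lemma normQnD_half f g u : 0 <= u -> normQn f <= u / 2 -> normQn g <= u / 2 ->
  normQn (f + g) <= u.
Proof.
move=> u0 fu gu; rewrite -(@ler_pXn2r _ 2)// ?nnegrE ?normQn_ge0//.
apply: (@le_trans _ _ (2 * normQn f ^+ 2 + 2 * normQn g ^+ 2)).
  rewrite !normQn_sqr !(mulrCA 2) -mulrDr ler_wpM2l ?invr_ge0 ?ler0n//.
  rewrite !mulr_sumr -big_split; apply: ler_sum => i _ /=; rewrite mxE.
  by have := sqr_ge0 (f 0 i - g 0 i); nra.
have f2 : normQn f ^+ 2 <= (u / 2) ^+ 2.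
  by rewrite lerXn2r// nnegrE ?normQn_ge0// divr_ge0.
have g2 : normQn g ^+ 2 <= (u / 2) ^+ 2.
  by rewrite lerXn2r// nnegrE ?normQn_ge0// divr_ge0.
by lra.
Qed.

Lemma normL2_uniform : normL2 (fun _ : 'I_n => n%:R^-1 : R) = @normQn R n.
Proof.
apply/funext => g; rewrite /normL2 /normQn /norm2 -mulr_sumr mulrC.
by rewrite sqrtrM ?sqrtrV ?ler0n// sumr_ge0// => i _; exact: sqr_ge0.
Qed.

(** Sizes of coverings are integers, so the infimum in the covering number is
attained; rounding exp (A0 / u) down loses nothing. *)
Lemma TV_ball_cover A0 u : TV_entropy_constant A0 -> 0 < u ->
  exists2 s, is_cover (@normQn R n) (@TV_ball R n) u s &
    (size s)%:R <= expR (A0 / u).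
Proof.
move=> hA u0.
have qP : is_prob_weight (fun _ : 'I_n => n%:R^-1 : R).
  split=> [i|]; first by rewrite invr_ge0 ler0n.
  by rewrite sumr_const card_ord -[LHS]mulr_natl divff// pnatr_eq0 -lt0n.
have := hA n _ u qP u0; rewrite normL2_uniform /entropy /covering_number.
set c := ereal_inf _ => ent.
have c_lt : (c < ((Num.truncn (expR (A0 / u))).+1%:R)%:E)%E.
  apply: (@le_lt_trans _ _ (expR (A0 / u))%:E); last first.
    by rewrite lte_fin truncnS_gt.
  have c0 : (0 <= c)%E.
    by apply: le_ereal_inf_tmp => _ [s _ <-]; rewrite lee_fin ler0n.
  have cI : c \in `[0%E, +oo%E] by rewrite in_itv/= c0 leey.
  by rewrite -(lneK cI) -[leRHS]/(expeR (A0 / u)%:E) lee_expeR.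
have [_ [s sC <-] ss] := ereal_inf_lt c_lt.
exists s => //; move: ss; rewrite lte_fin ltr_nat ltnS => ss.
rewrite (@le_trans _ _ (Num.truncn (expR (A0 / u)))%:R)// ?ler_nat//.
by rewrite truncn_le// expR_ge0.
Qed.

(** Chaining asks for nets with centers in the set itself. Each center of a net
of the ball is moved to a point of F within u / 2, when there is one; this
halves the admissible radius, whence the factor 2. *)
Lemma sub_TV_ball_cover A0 M (F : set 'rV[R]_n) u : TV_entropy_constant A0 ->
  0 < M -> 0 < u -> (forall f, F f -> `|f| <= M /\ TV f <= M) ->
  exists2 s, is_cover (@normQn R n) F u s &
    (size s)%:R <= expR (2 * M * A0 / u).
Proof.
move=> hA M0 u0 FM.
have uM : 0 < u / (2 * M) by rewrite divr_gt0// mulr_gt0.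
have [s [_ sC] ss] := TV_ball_cover hA uM.
pose near_center c f := F f /\ normQn (f - M *: c) <= u / 2.
have [pick pickP] : exists pick : 'rV[R]_n -> 'rV[R]_n,
    forall c f, near_center c f -> near_center c (pick c).
  suff /choice[pick pickP] : forall c, exists g,
    forall f, near_center c f -> near_center c g by exists pick.
  move=> c; have [[g gP]|no] := pselect (exists g, near_center c g).
    by exists g.
  by exists 0 => f cf; case: no; exists f.
exists [seq pick c | c <- s & `[< exists f, near_center c f >]]; last first.
  rewrite size_map; apply: le_trans (_ : (size s)%:R <= _).
    by rewrite ler_nat size_filter count_size.
  apply: (le_trans ss); rewrite ler_expR le_eqVlt; apply/orP; left; apply/eqP.
  by field; rewrite !gt_eqF.
split=> [g /mapP[c + ->]|f Ff].
  by rewrite mem_filter => /andP[/asboolP[f /pickP[]]].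
have [fM TVM] := FM f Ff.
have [|c cs fc] := sC (M^-1 *: f).
  split; first by rewrite normrZ gtr0_norm ?invr_gt0// ler_pdivrMl// mulr1.
  by rewrite TVZ gtr0_norm ?invr_gt0// ler_pdivrMl// mulr1.
have cf : near_center c f.
  split=> //; have -> : f - M *: c = M *: (M^-1 *: f - c).
    by rewrite scalerBr scalerA divff ?gt_eqF// scale1r.
  rewrite normQnZ gtr0_norm// -ler_pdivlMl//; apply: (le_trans fc).
  by rewrite le_eqVlt; apply/orP; left; apply/eqP; field; rewrite gt_eqF.
have [Fp pc] := pickP _ _ cf.
exists (pick c).
  apply/mapP; exists c => //; rewrite mem_filter cs andbT.
  by apply/asboolP; exists f.
have -> : f - pick c = (f - M *: c) + - (pick c - M *: c).
  by rewrite opprB addrA subrK.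
by apply: normQnD_half; [exact: ltW|case: cf|rewrite normQnN].
Qed.

End coverings.

(** * Chaining *)

Section chaining.
Context {R : realType} {n : nat}.
Hypothesis n_gt0 : (0 < n)%N.
Implicit Types (f g : 'rV[R]_n) (y : {ffun 'I_n -> bool}).

(** A crude bound valid for all labels, which ends the chains after finitely
many links. *)
Lemma noise_le_normQn f y g u : 0 < u -> normQn g <= u -> noise f y g <= u.
Proof.
move=> u0 gu; have n0 : 0 < n%:R :> R by rewrite ltr0n.
have g2 : normQn g ^+ 2 <= u ^+ 2.
  by rewrite lerXn2r// nnegrE ?normQn_ge0// ltW.
apply: (@le_trans _ _ (n%:R^-1 * \sum_(i < n) (u + u^-1 * g 0 i ^+ 2) / 2)).
  rewrite /noise ler_wpM2l ?invr_ge0 ?(ltW n0)//; apply: ler_sum => i _.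
  set e := (y i)%:R - _; have e1 : `|e| <= 1.
    have /andP[] := sigmoid_itv (f 0 i); rewrite /e ler_norml.
    by case: (y i) => /=; lra.
  apply: (le_trans (ler_norm _)); rewrite normrM.
  apply: (@le_trans _ _ `|g 0 i|); first by rewrite ler_piMl.
  rewrite -[g 0 i ^+ 2]real_normK ?num_real// ler_pdivlMr// -(ler_pM2l u0).
  have -> : u * (u + u^-1 * `|g 0 i| ^+ 2) = u ^+ 2 + `|g 0 i| ^+ 2.
    by field; rewrite gt_eqF.
  by have := sqr_ge0 (u - `|g 0 i|); nra.
rewrite -mulr_suml big_split/= sumr_const card_ord -mulr_sumr.
have -> : n%:R^-1 * ((u *+ n + u^-1 * \sum_(i < n) g 0 i ^+ 2) / 2) =
    (u + u^-1 * normQn g ^+ 2) / 2.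
  by rewrite normQn_sqr -[u *+ n]mulr_natl; field; rewrite !gt_eqF.
by rewrite ler_pdivrMr// mulr_natr mulr2n lerD2l ler_pdivrMl.
Qed.

Lemma sum_half_pow_le (S : nat) : \sum_(k < S) (2^-1 : R) ^+ k.+1 <= 1.
Proof.
suff -> : \sum_(k < S) (2^-1 : R) ^+ k.+1 = 1 - 2^-1 ^+ S.
  by rewrite gerBl exprn_ge0.
elim: S => [|S IH]; first by rewrite big_ord0 expr0 subrr.
by rewrite big_ord_recr /= IH exprS; lra.
Qed.

Lemma expR_Nnat_le k : expR (- (k%:R : R)) <= 2^-1 ^+ k.
Proof.
rewrite expRN exprVn lef_pV2 ?posrE ?exprn_gt0 ?expR_gt0//.
rewrite -[k%:R]mulr1 expRM_natl lerXn2r ?nnegrE ?expR_ge0//.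
by have := expR_ge1Dx (1 : R); rewrite (_ : 1 + 1 = 2).
Qed.

Lemma le_4_pow k : (k%:R : R) <= 4 ^+ k.
Proof. by rewrite -natrX ler_nat ltnW// ltn_expl. Qed.

(** Nets N k of F at scales r / 4^k, starting from N 0 = [:: 0], are linked by
maps c k that send a point of F to a nearby center. The links from N k.+1 to N
k are at most as many as the points of N k.+1, and have norm at most r / 4^k,
so a union bound over Hoeffding tails controls all of them at once. From one
scale to the next the norm of the links is divided by 4 while the square root
of their log-number only doubles, so the levels decrease like 2^-k. *)
Lemma chaining_tail f0 (F : set 'rV[R]_n) r h t eps :
  0 < r -> 0 <= h -> 0 <= t -> 0 < eps ->
  F 0 -> (forall f, F f -> normQn f <= r) ->
  (forall u, 0 < u ->
    exists2 s, is_cover (@normQn R n) F u s &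
      (size s)%:R <= expR (r * h / u)) ->
  exists2 good : pred {ffun 'I_n -> bool},
    \sum_(y | ~~ good y) label_weight f0 y <= expR (- t) &
    forall y, good y -> forall f, F f ->
      noise f0 y f <= 4 * r * Num.sqrt ((1 + t + h) / (2 * n%:R)) + eps.
Proof.
move=> r0 h0 t0 eps0 F0 Fr Fcov; have n0 : 0 < n%:R :> R by rewrite ltr0n.
set D := Num.sqrt _.
have p4 k : 0 < (4 : R) ^+ k by rewrite exprn_gt0.
have /choice[N NP] : forall k, exists s : seq 'rV[R]_n,
    [/\ is_cover (@normQn R n) F (r / 4 ^+ k) s,
        (size s)%:R <= expR (4 ^+ k * h) & k = 0 -> s = [:: 0]].
  case=> [|k].
    exists [:: 0]; split=> //=.
      split=> [g|f Ff]; first by rewrite inE => /eqP ->.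
      by exists 0; rewrite ?inE// expr0 divr1 subr0; exact: Fr.
    by rewrite expr0 mul1r -expR0 ler_expR.
  have [|s sF ss] := Fcov (r / 4 ^+ k.+1); first by rewrite divr_gt0.
  exists s; split => //; apply: (le_trans ss); rewrite ler_expR.
  by rewrite le_eqVlt; apply/orP; left; apply/eqP; field; rewrite !gt_eqF.
have /choice[c cP] : forall k, exists c : 'rV[R]_n -> 'rV[R]_n,
    forall g, F g -> [/\ c g \in N k, F (c g) & normQn (g - c g) <= r / 4 ^+ k].
  move=> k; have [[NF Ncov] _ _] := NP k.
  suff /choice[c cP] : forall g, exists c, F g ->
      [/\ c \in N k, F c & normQn (g - c) <= r / 4 ^+ k] by exists c.
  move=> g; have [Fg|] := pselect (F g); last by exists 0.
  by have [c cN gc] := Ncov g Fg; exists c => _; split=> //; exact: NF.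
have NF k g : g \in N k -> F g by have [[+ _] _ _] := NP k; apply.
(* x k exceeds the log-size 4^(k+1) h of N k.+1 by 4^(k+1) (1 + t), and a k is
   the level that a link of norm r / 4^k exceeds with probability at most
   e^(- x k). *)
pose x k := 4 ^+ k.+1 * (1 + t + h).
pose a k := r / 4 ^+ k * Num.sqrt (x k / (2 * n%:R)).
have th0 : 0 <= 1 + t + h by lra.
have aE k : a k = 4 * r * D * 2^-1 ^+ k.+1.
  have -> : a k = r / 4 ^+ k * (2 ^+ k.+1 * D).
    rewrite /a /x; congr (_ * _).
    have -> : (4 : R) ^+ k.+1 = (2 ^+ k.+1) ^+ 2.
      by rewrite -exprM mulnC exprM; congr (_ ^+ _); ring.
    by rewrite -mulrA sqrtrM ?sqr_ge0// sqrtr_sqr ger0_norm// exprn_ge0.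
  rewrite exprVn !exprS.
  have -> : (4 : R) ^+ k = 2 ^+ k * 2 ^+ k.
    by rewrite -exprMn; congr (_ ^+ _); ring.
  by field; rewrite gt_eqF// exprn_gt0.
(* After S links the chain is within eps of its end point. *)
have [S Seps] : exists S, r / 4 ^+ S <= eps.
  exists (Num.truncn (r / eps)).+1; rewrite ler_pdivrMr// -ler_pdivrMl//.
  rewrite mulrC (le_trans (ltW (truncnS_gt _)))// le_4_pow//.
exists (fun y => [forall k : 'I_S,
    all (fun g => noise f0 y (g - c k g) <= a k) (N k.+1)]).
  have w0 y := label_weight_ge0 f0 y.
  apply: (@le_trans _ _ (\sum_(k < S) \sum_(g <- N k.+1)
      \sum_(y | a k < noise f0 y (g - c k g)) label_weight f0 y)).
    (* Union bound: a bad label vector makes some link (k, g) too large. *)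
    under [leRHS]eq_bigr => k _ do (under eq_bigr => g _ do rewrite big_mkcond).
    under [leRHS]eq_bigr => k _ do rewrite exchange_big.
    rewrite [leRHS]exchange_big /= big_mkcond; apply: ler_sum => y _.
    have ge0 g k : 0 <=
        (if a k < noise f0 y (g - c k g) then label_weight f0 y else 0).
      by case: ifP.
    case: ifPn => [|_]; last by apply: sumr_ge0 => k _; apply: sumr_ge0.
    move=> /forallPn[k /allPn[g gN]]; rewrite -ltNge => yg.
    rewrite (bigD1 k) //= -[leLHS]addr0 lerD ?sumr_ge0//; last first.
      by move=> j _; apply: sumr_ge0.
    rewrite (big_rem g gN)/= yg lerDl; exact: sumr_ge0.
  apply: (@le_trans _ _ (\sum_(k < S) expR (- t) * 2^-1 ^+ k.+1)); last first.
    by rewrite -mulr_sumr ler_piMr ?expR_ge0// sum_half_pow_le.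
  apply: ler_sum => k _.
  apply: (@le_trans _ _ (\sum_(g <- N k.+1) expR (- x k))).
    rewrite big_seq [leRHS]big_seq; apply: ler_sum => g gN.
    apply: noise_tail => //; first by rewrite divr_gt0.
      by rewrite mulr_ge0// ltW.
    by have [] := cP k g (NF _ _ gN).
  rewrite big_const_seq count_predT iter_addr addr0 -[leLHS]mulr_natl.
  have [_ ss _] := NP k.+1.
  apply: (@le_trans _ _ (expR (4 ^+ k.+1 * h) * expR (- x k))).
    by rewrite ler_wpM2r// expR_ge0.
  apply: (@le_trans _ _ (expR (- t) * expR (- k.+1%:R))); last first.
    by rewrite ler_wpM2l ?expR_ge0// expR_Nnat_le.
  rewrite -!expRD ler_expR /x.
  have := le_4_pow k.+1.
  have : (1 : R) <= 4 ^+ k.+1 by rewrite exprn_ege1// ler1n.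
  set q := 4 ^+ _; set m := _%:R => q1 mq; nra.
move=> y /forallP good f Ff.
(* The links crossed from level 0 to level k add up. *)
have chain k g : (k <= S)%N -> g \in N k -> noise f0 y g <= \sum_(j < k) a j.
  elim: k g => [|k IH] g kS gN.
    have [_ _ N0] := NP 0; move: gN; rewrite N0// inE => /eqP ->.
    by rewrite big_ord0 /noise big1 ?mulr0// => i _; rewrite mxE mulr0.
  have [cN _ _] := cP k g (NF _ _ gN).
  rewrite big_ord_recr /= -{1}[g](subrKC (c k g)) noiseD lerD//.
    by apply: IH => //; exact: ltnW.
  by have /allP := good (Ordinal kS); exact.
have [cN _ fc] := cP S f Ff.
rewrite -{1}[f](subrKC (c S f)) noiseD lerD//.
  apply: (le_trans (chain S _ (leqnn _) cN)).
  under eq_bigr do rewrite aE.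
  rewrite -mulr_sumr ler_piMr ?sum_half_pow_le//.
  by rewrite !mulr_ge0// ?sqrtr_ge0// ltW.
by apply: noise_le_normQn => //; exact: le_trans Seps.
Qed.

End chaining.

(** * Minimizers of the penalized risk *)

Section continuity.
Context {R : realType} {n : nat}.

Lemma softplus_continuous : continuous (@softplus R).
Proof.
move=> z; apply/differentiable_continuous/derivable1_diffP.
by case: (is_derive_softplus z).
Qed.

(** Composing with an arbitrary x keeps the domain an abstract topological
space; only its coordinates matter. *)
Lemma TV_objective_comp_continuous (T : topologicalType) lambda
    (y : {ffun 'I_n -> bool}) (x : T -> 'rV[R]_n) :
  (forall i, continuous (fun t => x t 0 i)) ->
  continuous (fun t => TV_objective lambda y (x t)).
Proof.
move=> coordC.
have lossC i : continuous (fun t =>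
    - ((y i)%:R * x t 0 i) + softplus (x t 0 i)).
  move=> t; apply: cvgD.
    by apply: cvgN; apply: cvgM; [exact: cvg_cst|exact: coordC].
  apply: (@continuous_comp _ _ _ (fun t => x t 0 i) softplus).
    exact: coordC.
  exact: softplus_continuous.
have jumpC (p : 'I_n * 'I_n) : continuous (fun t => `|x t 0 p.2 - x t 0 p.1|).
  move=> t.
  apply: (@continuous_comp _ _ _ (fun t => x t 0 p.2 - x t 0 p.1)
    Num.norm); last exact: norm_continuous.
  by apply: cvgB; exact: coordC.
have riskC : continuous (fun t =>
    \sum_i (- ((y i)%:R * x t 0 i) + softplus (x t 0 i))).
  exact: (continuous_big add_continuous).
have TVC : continuous (fun t => TV (x t)).
  exact: (continuous_big add_continuous).
move=> t; apply: cvgD.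
  by apply: cvgM; [exact: cvg_cst|exact: riskC].
by apply: cvgM; [exact: cvg_cst|exact: TVC].
Qed.

Lemma TV_objective_continuous lambda (y : {ffun 'I_n -> bool}) :
  continuous (@TV_objective R n lambda y).
Proof.
apply: (TV_objective_comp_continuous (x := id)) => i.
exact: coord_continuous.
Qed.

End continuity.

Section basic_inequality.
Context {R : realType} {n : nat}.
Variables (lambda K : R).
Hypothesis lambda_gt0 : 0 < lambda.
Implicit Types (f g : 'rV[R]_n) (y : {ffun 'I_n -> bool}).

(** Left-hand side of the theorem, as a function of the error g = fhat - f0. *)
Definition gauge g := normQn g ^+ 2 / (2 * K ^+ 2) + lambda * TV g.

(** The risk splits into its conditional mean, whose excess is a Bregman
divergence, and a part linear in f, the noise. *)
Lemma logistic_excess f0 y f :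
  logistic_risk y f - logistic_risk y f0 =
  n%:R^-1 * \sum_i bregman_softplus (f 0 i) (f0 0 i) - noise f0 y (f - f0).
Proof.
rewrite /logistic_risk /noise -!mulrBr -!sumrB; congr (_ * _).
apply: eq_bigr => i _; rewrite !mxE /bregman_softplus /softplus; ring.
Qed.

Lemma basic_inequality B f0 y f :
  K ^+ 2 = (1 + expR B) ^+ 2 / expR B -> `|f0| <= B -> `|f| <= B ->
  gauge (f - f0) <= TV_objective lambda y f - TV_objective lambda y f0
    + noise f0 y (f - f0) + 2 * lambda * TV f0.
Proof.
move=> KB f0B fB; have B0 := le_trans (normr_ge0 _) fB.
have fiB := (rV_norm_le f B0).1 fB; have f0iB := (rV_norm_le f0 B0).1 f0B.
have risk : normQn (f - f0) ^+ 2 / (2 * K ^+ 2) <=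
    n%:R^-1 * \sum_i bregman_softplus (f 0 i) (f0 0 i).
  rewrite normQn_sqr -mulrA ler_wpM2l ?invr_ge0 ?ler0n// mulr_suml.
  apply: ler_sum => i _; have := bregman_softplus_ge (fiB i) (f0iB i).
  apply: le_trans; rewrite KB !mxE le_eqVlt; apply/orP; left; apply/eqP.
  by field; rewrite !gt_eqF ?expR_gt0 ?oneDexpR_gt0.
have TVle : TV (f - f0) <= TV f + TV f0 by rewrite -[TV f0]TVN TVD.
have := logistic_excess f0 y f.
have := ler_wpM2l (ltW lambda_gt0) TVle.
rewrite /gauge /TV_objective mulrDr; lra.
Qed.

Lemma TV_objective_convex y f0 f s : 0 <= s <= 1 ->
  TV_objective lambda y (f0 + s *: (f - f0)) <=
  (1 - s) * TV_objective lambda y f0 + s * TV_objective lambda y f.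
Proof.
move=> s01; have /andP[s0 s1] := s01.
have riskC : logistic_risk y (f0 + s *: (f - f0)) <=
    (1 - s) * logistic_risk y f0 + s * logistic_risk y f.
  rewrite /logistic_risk !(mulrCA _ n%:R^-1) -mulrDr.
  rewrite ler_wpM2l ?invr_ge0 ?ler0n// !mulr_sumr -big_split.
  apply: ler_sum => i _ /=; rewrite !mxE.
  by have := softplus_convex (f0 0 i) (f 0 i) s01; rewrite /softplus; lra.
have TVC : TV (f0 + s *: (f - f0)) <= (1 - s) * TV f0 + s * TV f.
  have -> : f0 + s *: (f - f0) = (1 - s) *: f0 + s *: f.
    by apply/rowP => i; rewrite !mxE; ring.
  by rewrite (le_trans (TVD _ _))// !TVZ !ger0_norm// subr_ge0.
have := ler_wpM2l (ltW lambda_gt0) TVC.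
rewrite /TV_objective; lra.
Qed.

Lemma gauge0 : gauge 0 = 0.
Proof.
rewrite /gauge -[0 : 'rV[R]_n](scale0r 0) normQnZ TVZ normr0 !mul0r.
by rewrite expr0n /= mul0r mulr0 addr0.
Qed.

(** The gauge is not homogeneous, but it is continuous along rays. *)
Lemma gauge_scale_level g (L : R) : 0 <= L -> L < gauge g ->
  exists2 s : R, 0 <= s <= 1 & gauge (s *: g) = L.
Proof.
move=> L0 Lg.
pose psi s := s ^+ 2 * (normQn g ^+ 2 / (2 * K ^+ 2)) + s * (lambda * TV g).
have [s sI sL] : exists2 s, s \in `[0, 1] & psi s = L.
  apply: IVT => //.
    apply: continuous_subspaceT => s; apply: cvgD; apply: cvgM.
    - exact: exprn_continuous.
    - exact: cvg_cst.
    - exact: cvg_id.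
    - exact: cvg_cst.
  have -> : psi 0 = 0 by rewrite /psi expr0n /= !mul0r addr0.
  have -> : psi 1 = gauge g by rewrite /psi expr1n !mul1r.
  have g0 : 0 <= gauge g by exact: le_trans (ltW Lg).
  by rewrite min_l// max_r// L0 ltW.
exists s; first by rewrite !(itvP sI).
rewrite -sL /gauge /psi normQnZ TVZ ger0_norm; first by rewrite exprMn; ring.
by rewrite (itvP sI).
Qed.

Variables (B L r : R) (f0 : 'rV[R]_n) (y : {ffun 'I_n -> bool}).
Hypotheses (KB : K ^+ 2 = (1 + expR B) ^+ 2 / expR B) (L0 : 0 <= L).
Hypotheses (f0rB : `|f0| + r <= B).
Hypothesis gauge_norm : forall g, gauge g <= L -> `|g| <= r.
Hypothesis small_noise : forall g, gauge g <= L ->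
  noise f0 y g + 2 * lambda * TV f0 < L.

(** At the point of the segment from f0 to f where the gauge equals L, the
basic inequality and the small noise make the objective larger than at f0. By
convexity it is then larger at f as well. *)
Lemma objective_gt_outside f : L < gauge (f - f0) ->
  TV_objective lambda y f0 < TV_objective lambda y f.
Proof.
move=> Lf; have [s s01 sL] := gauge_scale_level L0 Lf.
have gs : gauge (s *: (f - f0)) <= L by rewrite sL.
have r0 : 0 <= r by exact: le_trans (gauge_norm gs).
have := @basic_inequality B f0 y (f0 + s *: (f - f0)) KB.
rewrite addrAC subrr add0r sL.
have -> : `|f0| <= B by apply: le_trans f0rB; rewrite lerDl.
have -> : `|f0 + s *: (f - f0)| <= B.
  apply: le_trans f0rB.
  by rewrite (le_trans (ler_normD _ _))// lerD2l gauge_norm.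
move=> /(_ isT isT); have := small_noise gs.
have := TV_objective_convex y f0 f s01; have /andP[s0 _] := s01.
move: (TV_objective lambda y f) (TV_objective lambda y f0) => u v.
move=> h1 h2 h3; have : 0 < s * (u - v) by lra.
by rewrite pmulr_rgt0 ?subr_gt0 ?lt_neqAle ?s0 ?andbT; nra.
Qed.

(** A minimizer over the cube of radius r around f0, which contains the gauge
ball, is a global one: outside the ball the objective exceeds its
value at f0. *)
Lemma argmin_exists : argmin (TV_objective lambda y) !=set0.
Proof.
pose A : set 'rV[R]_n :=
  [set f | forall i, f ord0 i \in `[f0 ord0 i - r, f0 ord0 i + r]].
have r0 : 0 <= r.
  by apply: le_trans (normr_ge0 _) (gauge_norm (g := 0) _); rewrite gauge0.
have AP f : A f <-> `|f - f0| <= r.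
  split=> [Af|/(rV_norm_le _ r0) h i].
    apply/(rV_norm_le _ r0) => i; rewrite !mxE ler_distl.
    by have := Af i; rewrite in_itv.
  by have := h i; rewrite !mxE ler_distl in_itv.
have A0 : A f0 by apply/AP; rewrite subrr normr0.
have [|||c _ cmin] := @compact_EVT_min _ R (TV_objective lambda y) A.
- by exists f0.
- apply: (@rV_compact _ _
    (fun i => `[f0 ord0 i - r, f0 ord0 i + r]%classic)) => i.
  exact: segment_compact.
- exact/continuous_subspaceT/TV_objective_continuous.
exists c => f; have [gf|gf] := leP (gauge (f - f0)) L.
  by apply: cmin; rewrite inE; apply/AP/gauge_norm.
apply: le_trans (ltW (objective_gt_outside gf)).
by apply: cmin; rewrite inE.
Qed.

Lemma argmin_in_gauge_ball f :
  argmin (TV_objective lambda y) f -> gauge (f - f0) <= L.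
Proof.
move=> fmin; rewrite leNgt; apply/negP => /objective_gt_outside.
by rewrite ltNge fmin.
Qed.

End basic_inequality.

(** * The oracle inequality *)

(** A covering of a nonempty set has a point, so every entropy is
nonnegative. *)
Lemma TV_entropy_constant_ge0 (R : realType) (A0 : R) :
  TV_entropy_constant A0 -> 0 <= A0.
Proof.
move=> hA.
have [s [_ cov] ss] := TV_ball_cover (ltn0Sn 0) hA (ltr01 : 0 < 1 :> R).
have [|g gs _] := cov 0.
  split; first by rewrite normr0.
  by rewrite -[0 : 'rV[R]_1](scale0r 0) TVZ normr0 mul0r.
rewrite -[A0]divr1 -ler_expR expR0; apply: le_trans ss.
by rewrite ler1n; case: s gs {cov}.
Qed.

Lemma sigmoid_logit (R : realType) (p : R) :
  0 < p < 1 -> sigmoid (ln (p / (1 - p))) = p.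
Proof.
move=> /andP[p0 p1]; have q0 : 0 < 1 - p by rewrite subr_gt0.
rewrite /sigmoid lnK ?posrE ?divr_gt0//; field.
by rewrite subrK oner_eq0 gt_eqF.
Qed.

(** Third power of the lower bound on lambda, which clears the fractional
exponents. *)
Lemma entropy_level_cubed (R : realType) (m A k lambda c : R) :
  0 < m -> 0 <= A -> 0 <= k -> 0 <= c ->
  c * (m `^ (- (2 / 3))) * (A `^ (2 / 3)) * (k `^ (1 / 3)) <= lambda ->
  c ^+ 3 * (A / m) ^+ 2 * k <= lambda ^+ 3.
Proof.
move=> m0 A0 k0 c0 le_lambda.
have pow3 a x : (a `^ x) ^+ 3 = a `^ (x * 3) :> R.
  by rewrite -powR_mulrn ?powR_ge0// -powRrM.
apply: (@le_trans _ _
    ((c * (m `^ (- (2 / 3))) * (A `^ (2 / 3)) * (k `^ (1 / 3))) ^+ 3)).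
  rewrite le_eqVlt; apply/orP; left; apply/eqP.
  rewrite !exprMn !pow3.
  have -> : - (2 / 3) * 3 = - 2%:R :> R by field.
  have -> : 2 / 3 * 3 = 2%:R :> R by field.
  have -> : 1 / 3 * 3 = 1 :> R by field.
  rewrite powRN !powR_mulrn ?(ltW m0)// powRr1// exprVn.
  by field; rewrite gt_eqF.
rewrite lerXn2r// nnegrE.
  by rewrite !mulr_ge0 ?powR_ge0.
by apply: le_trans le_lambda; rewrite !mulr_ge0 ?powR_ge0.
Qed.

(** Squared, the left-hand side is 8 r^2 (1 + t) / m + 80 M r A / m. The bound
on (1 + t) / m makes the first term at most 2^-3 lambda^2 M^2, and the cubed
bound makes the second at most 80 2^-11 lambda^2 M^2. *)
Lemma chaining_level_le (R : realType) (m A k lambda M t r : R) :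
  0 < m -> 0 <= A -> 0 < k -> 0 < lambda -> 1 <= M -> 0 < r ->
  r ^+ 2 = 4 * k * lambda * M ->
  2 ^+ 24 * (A / m) ^+ 2 * k <= lambda ^+ 3 ->
  2 ^+ 8 * k * ((1 + t) / m) <= lambda ->
  0 <= 1 + t ->
  4 * r * Num.sqrt ((1 + t + 10 * M * A / r) / (2 * m)) <= lambda * M.
Proof.
move=> m0 A0 k0 l0 M1 r0 r2 hA ht t0.
have M0 : 0 < M by lra.
have Am0 : 0 <= A / m by rewrite divr_ge0// ltW.
have lM0 : 0 <= lambda * M by rewrite mulr_ge0// ltW.
have rA : r * (A / m) <= lambda ^+ 2 * M / 2 ^+ 11.
  rewrite -(@ler_pXn2r _ 2)// ?nnegrE; last 2 first.
  - by rewrite mulr_ge0// ltW.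
  - by rewrite divr_ge0 ?exprn_ge0// mulr_ge0 ?exprn_ge0// ltW.
  rewrite exprMn r2.
  have -> : (lambda ^+ 2 * M / 2 ^+ 11) ^+ 2 =
      4 * lambda * M * (M * (lambda ^+ 3 / 2 ^+ 24)) by field.
  have -> : 4 * k * lambda * M * (A / m) ^+ 2 =
      4 * lambda * M * (1 * ((A / m) ^+ 2 * k)) by ring.
  apply: ler_wpM2l; first by rewrite !mulr_ge0// ltW.
  apply: ler_pM => //; first by rewrite mulr_ge0 ?sqr_ge0// ltW.
  by rewrite ler_pdivlMr ?exprn_gt0// mulrC mulrA.
have rt : r ^+ 2 * ((1 + t) / m) <= lambda ^+ 2 * M / 2 ^+ 6.
  rewrite r2.
  have -> : 4 * k * lambda * M * ((1 + t) / m) =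
      lambda * M / 2 ^+ 6 * (2 ^+ 8 * k * ((1 + t) / m)).
    by field; rewrite gt_eqF.
  have -> : lambda ^+ 2 * M / 2 ^+ 6 = lambda * M / 2 ^+ 6 * lambda by field.
  by apply: ler_wpM2l => //; rewrite divr_ge0// exprn_ge0.
rewrite -(@ler_pXn2r _ 2)// ?nnegrE; last first.
  by rewrite !mulr_ge0 ?sqrtr_ge0// ltW.
have h0 : 0 <= 10 * M * A / r.
  by rewrite divr_ge0 ?(ltW r0)// mulr_ge0// mulr_ge0// ltW.
rewrite exprMn sqr_sqrtr; last first.
  by apply: divr_ge0; [exact: addr_ge0|rewrite mulr_ge0// ltW].
have -> : (4 * r) ^+ 2 * ((1 + t + 10 * M * A / r) / (2 * m)) =
    8 * (r ^+ 2 * ((1 + t) / m)) + 80 * M * (r * (A / m)).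
  by field; rewrite !gt_eqF.
have MrA : 80 * M * (r * (A / m)) <= 80 * M * (lambda ^+ 2 * M / 2 ^+ 11).
  by apply: ler_wpM2l => //; rewrite mulr_ge0// ltW.
have : lambda ^+ 2 * M <= (lambda * M) ^+ 2.
  by rewrite exprMn ler_wpM2l ?sqr_ge0// expr2 ler_peMr// ltW.
have : 80 * M * (lambda ^+ 2 * M / 2 ^+ 11) = 80 / 2 ^+ 11 * (lambda * M) ^+ 2.
  by field.
have : 0 <= (lambda * M) ^+ 2 by exact: sqr_ge0.
move: rt MrA.
have -> : (2 : R) ^+ 11 = 2048 by ring.
have -> : (2 : R) ^+ 6 = 64 by ring.
lra.
Qed.

Theorem theorem3p1 (R : realType) (A0 : R) (hA0 : TV_entropy_constant A0)
    (d : measure_display) (T : measurableType d) (P : probability T R)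
    (n : nat) (hn : (0 < n)%N)
    (Y : 'I_n -> {RV P >-> bool}) (hindep : mutually_independent Y)
    (htheta : forall i, 0 < success_prob (Y i) < 1)
    (f0 : 'rV[R]_n) (hf0 : f0 = log_odds Y)
    (lambda : R) (fhat : {ffun 'I_n -> bool} -> 'rV[R]_n)
    (hfhat : is_TV_logistic_estimator lambda fhat)
    (M0 : R) (hM0 : 1 <= M0) (hTV : TV f0 <= M0)
    (K : R) (hK : 0 < K)
    (hK2 : K ^+ 2 = (1 + expR (1 + 2 ^+ 4 * M0 + `|f0|)) ^+ 2
                    / expR (1 + 2 ^+ 4 * M0 + `|f0|))
    (t : R) (ht : 0 < t)
    (hlambda1 : lambda <= (2 ^+ 4 * (2 * K ^+ 2) * M0)^-1)
    (hlambda2 : 2 ^+ 8 * (n%:R `^ (- (2 / 3))) * (A0 `^ (2 / 3))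
                * ((2 * K ^+ 2) `^ (1 / 3)) <= lambda)
    (hlambda3 : 2 ^+ 8 * (2 * K ^+ 2) * ((1 + t) / n%:R) <= lambda) :
  ((1 - expR (- t))%:E <=
   P [set w | let fh := fhat [ffun i => Y i w] in
        (normQn (fh - f0) ^+ 2 / (2 * K ^+ 2) + lambda * TV (fh - f0)
          <= 4 * lambda * M0)%R
        /\ (`|fh - f0| <= (1 + 8 * M0) / 2)%R])%E.
Proof.
have n0 : 0 < n%:R :> R by rewrite ltr0n.
have M0_gt0 : 0 < M0 by lra.
have t1 : 0 < 1 + t by lra.
set k := 2 * K ^+ 2 in hlambda1 hlambda2 hlambda3.
have k0 : 0 < k by rewrite /k mulr_gt0// exprn_gt0.
have l0 : 0 < lambda.
  apply: lt_le_trans hlambda3; rewrite mulr_gt0 ?divr_gt0//.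
  by rewrite mulr_gt0// exprn_gt0.
have A0_ge0 := TV_entropy_constant_ge0 hA0.
pose L := 4 * lambda * M0; have L0 : 0 < L by rewrite !mulr_gt0.
have kL0 : 0 < k * L by rewrite mulr_gt0.
pose r := Num.sqrt (k * L).
have r2 : r ^+ 2 = 4 * k * lambda * M0.
  by rewrite sqr_sqrtr ?ltW// /L; ring.
have r0 : 0 < r by rewrite sqrtr_gt0.
have r_half : r <= 1 / 2.
  rewrite -(@ler_pXn2r _ 2)// ?nnegrE ?(ltW r0)// ?divr_ge0// r2.
  move: hlambda1; rewrite -[X in _ <= X]div1r.
  rewrite ler_pdivlMr ?mulr_gt0 ?exprn_gt0//.
  by rewrite expr_div_n => ?; lra.
pose ball : set 'rV[R]_n := [set g | gauge lambda K g <= L].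
have ball_TV g : ball g -> TV g <= 4 * M0.
  rewrite /ball /= /gauge => gL; rewrite -(ler_pM2l l0).
  have : 0 <= normQn g ^+ 2 / (2 * K ^+ 2).
    by rewrite divr_ge0 ?sqr_ge0// mulr_ge0 ?sqr_ge0.
  by move: gL; rewrite /L; lra.
have ball_Qn g : ball g -> normQn g <= r.
  rewrite /ball /= /gauge -/k => gL.
  rewrite -(@ler_pXn2r _ 2)// ?nnegrE ?normQn_ge0 ?(ltW r0)//.
  rewrite sqr_sqrtr ?(ltW kL0)// mulrC -ler_pdivrMr//.
  by apply: le_trans gL; rewrite lerDl mulr_ge0 ?TV_ge0// ltW.
have ball_norm g : ball g -> `|g| <= (1 + 8 * M0) / 2.
  move=> gB; have := norm_le_TV_normQn g hn.
  by have := ball_TV g gB; have := ball_Qn g gB; lra.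
have ball0 : ball 0.
  by rewrite /ball /= gauge0 ltW.
pose h := 10 * M0 * A0 / r.
have h0 : 0 <= h by rewrite divr_ge0 ?mulr_ge0 ?(ltW M0_gt0) ?(ltW r0).
(* 4 M0 + 1/2 <= 5 M0 puts the ball inside 5 M0 times the unit TV ball. *)
have ball_cover u : 0 < u -> exists2 s, is_cover (@normQn R n) ball u s &
    (size s)%:R <= expR (r * h / u).
  move=> u0; have M5 : 0 < 5 * M0 by rewrite mulr_gt0.
  have [|s sC ss] := sub_TV_ball_cover hn (F := ball) hA0 M5 u0.
    by move=> g gB; have := ball_norm g gB; have := ball_TV g gB; split; lra.
  exists s => //; apply: (le_trans ss); rewrite ler_expR.
  rewrite le_eqVlt; apply/orP; left; apply/eqP.
  by rewrite /h; field; rewrite !gt_eqF.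
(* The noise budget is L - 2 lambda M0 = 2 lambda M0: the chain takes
   lambda M0, its remainder lambda M0 / 2, and the rest gives strictness. *)
have eps0 : 0 < lambda * M0 / 2 by rewrite divr_gt0// mulr_gt0.
have [good good_prob good_noise] :=
  chaining_tail hn f0 r0 h0 (ltW ht) eps0 ball0 ball_Qn ball_cover.
have level : 4 * r * Num.sqrt ((1 + t + h) / (2 * n%:R)) <= lambda * M0.
  apply: (chaining_level_le n0 A0_ge0 k0) => //; last exact: ltW.
  rewrite (_ : 2 ^+ 24 = (2 ^+ 8) ^+ 3); last by rewrite -exprM.
  exact: (entropy_level_cubed n0 A0_ge0 (ltW k0) (exprn_ge0 _ _) hlambda2).
have f0B : `|f0| + (1 + 8 * M0) / 2 <= 1 + 2 ^+ 4 * M0 + `|f0|.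
  have -> : (2 : R) ^+ 4 = 16 by ring.
  lra.
have small y : good y -> forall g, gauge lambda K g <= L ->
    noise f0 y g + 2 * lambda * TV f0 < L.
  move=> gy g gB; have := good_noise y gy g gB.
  have := ler_wpM2l (ltW l0) hTV; have : 0 < lambda * M0 by rewrite mulr_gt0.
  by move: level; rewrite /L; lra.
pose Q (y : {ffun 'I_n -> bool}) :=
  (gauge lambda K (fhat y - f0) <= L) && (`|fhat y - f0| <= (1 + 8 * M0) / 2).
have goodQ y : good y -> Q y.
  move=> gy; have noise_y := small y gy.
  have ex := argmin_exists l0 hK2 (ltW L0) f0B ball_norm noise_y.
  have fB := argmin_in_gauge_ball l0 hK2 (ltW L0) f0B ball_norm noise_y
    (hfhat y ex).
  by rewrite /Q fB ball_norm.
have weightE : bernoulli_weight (fun i => success_prob (Y i)) =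
    label_weight f0.
  apply/funext => y; rewrite /label_weight /bernoulli_weight.
  by apply: eq_bigr => i _; rewrite hf0 mxE sigmoid_logit.
rewrite (_ : [set w | _] = [set w | Q [ffun i => Y i w]]); last first.
  by apply/seteqP; split=> w /=; rewrite /Q /gauge => /andP.
rewrite (independent_labels_law _ hindep) weightE lee_fin.
have total : \sum_(y | good y) label_weight f0 y
    + \sum_(y | ~~ good y) label_weight f0 y = 1.
  by rewrite -(bigID good xpredT) /= sum_bernoulli_weight.
have : \sum_(y | good y) label_weight f0 y <= \sum_(y | Q y) label_weight f0 y.
  rewrite !(big_mkcond _ (label_weight f0)) /=; apply: ler_sum => y _.
  case: ifPn => [/goodQ ->//|_]; case: ifP => // _; exact: label_weight_ge0.
by move: total good_prob; lra.
Qed.
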